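(* Let $k$ be a complete valuation field with non-trivial valuation. (1) For any free Banach $k$-vector space $V$, the $O_k$-module $V^{\vee}$ is cofree; in addition, if $k$ is non-spherically complete, then the canonical $k$-linear homomorphism $V \to V^{\vee\vee}$, $v \mapsto (m \mapsto m(v))$, is an isometric isomorphism. (2) If $k$ is non-spherically complete, then for any cofree $O_k$-module $M$, the Banach $k$-vector space $M^{\vee}$ is free, and the canonical $O_k$-linear homomorphism $M \to M^{\vee\vee}$, $m \mapsto (v \mapsto v(m))$, is an isomorphism.
   Context: A complete valuation field is a field $k$ complete with respect to a multiplicative ultrametric absolute value $|\cdot|\colon k\to\mathbb{R}_{\ge 0}$; $O_k=\{c\in k : |c|\le 1\}$. It is non-spherically complete if there is a sequence of closed balls in $k$ with the finite intersection property and empty intersection. A Banach $k$-vector space is a $k$-vector space complete with respect to an ultrametric norm $\|\cdot\|$ with $\|cv\|=|c|\,\|v\|$. For a Banach $k$-vector space $V$, $V^{\vee}$ denotes the $O_k$-module (without topology) of $k$-linear maps $m\colon V\to k$ with $|m(v)|\le\|v\|$ for all $v$. For an $O_k$-module $M$, $M^{\vee}$ denotes the Banach $k$-vector space of bounded $O_k$-linear maps $M\to k$ with the supremum norm $\|v\|=\sup_{m\in M}|v(m)|$. The double dual $V^{\vee\vee}=(V^\vee)^\vee$ is thus a Banach space and $M^{\vee\vee}=(M^\vee)^\vee$ an $O_k$-module. A set $I$ is non-measurable if it is not the case that $\#I\ge\aleph_1$ and $\#I$ carries a non-principal ultrafilter closed under countable intersections. $\mathrm{C}_0(I,k)$ is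 the Banach space, with supremum norm, of maps $f\colon I\to k$ such that $\{i\in I : |f(i)|\ge\epsilon\}$ is finite for every $\epsilon>0$. A Banach $k$-vector space $V$ is free if there is an isometric $k$-linear isomorphism $\mathrm{C}_0(I,k)\to V$ for some non-measurable set $I$. An $O_k$-module $M$ is cofree if there is an $O_k$-linear isomorphism $M\to O_k^I$ (direct product) for some non-measurable set $I$. *)

(* Defs.v *)
From HB Require Import structures.
From mathcomp Require Import all_boot all_order all_algebra.
From mathcomp Require Import boolp classical_sets functions cardinality filter.
From mathcomp Require Import reals ring.

Set Implicit Arguments.
Unset Strict Implicit.
Unset Printing Implicit Defensive.

Import Order.TTheory GRing.Theory Num.Theory.

Local Open Scope classical_set_scope.
Local Open Scope ring_scope.

Definition dist_cauchy (R : realType) (T : Type) (d : T -> T -> R)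
    (u : nat -> T) : Prop :=
  forall e : R, 0 < e -> exists N : nat,
    forall m n : nat, (N <= m)%N -> (N <= n)%N -> d (u m) (u n) < e.

Definition dist_cvg (R : realType) (T : Type) (d : T -> T -> R)
    (u : nat -> T) (l : T) : Prop :=
  forall e : R, 0 < e -> exists N : nat,
    forall n : nat, (N <= n)%N -> d (u n) l < e.

Definition dist_complete (R : realType) (T : Type) (d : T -> T -> R) : Prop :=
  forall u : nat -> T, dist_cauchy d u -> exists l : T, dist_cvg d u l.

HB.mixin Record Field_isCompleteValuation (R : realType) k of GRing.Field k := {
  vabs : k -> R;
  vabs_ge0 : forall x, 0 <= vabs x;
  vabs_eq0 : forall x, vabs x = 0 <-> x = 0;
  vabsM : forall x y, vabs (x * y) = vabs x * vabs y;
  vabs_ultra : forall x y, vabs (x + y) <= Num.max (vabs x) (vabs y);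
  vabs_complete : dist_complete (fun x y => vabs (x - y))
}.

#[short(type="completeValuationFieldType")]
HB.structure Definition CompleteValuationField (R : realType) :=
  { k of GRing.Field k & Field_isCompleteValuation R k }.

HB.mixin Record Lmodule_isBanach (R : realType)
    (k : completeValuationFieldType R) V of GRing.Lmodule k V := {
  bnorm : V -> R;
  bnorm_ge0 : forall v, 0 <= bnorm v;
  bnorm_eq0 : forall v, bnorm v = 0 <-> v = 0;
  bnormZ : forall (c : k) v, bnorm (c *: v) = vabs c * bnorm v;
  bnorm_ultra : forall u v, bnorm (u + v) <= Num.max (bnorm u) (bnorm v);
  bnorm_complete : dist_complete (fun u v => bnorm (u - v))
}.

#[short(type="banachType")]
HB.structure Definition Banach (R : realType)
    (k : completeValuationFieldType R) :=
  { V of GRing.Lmodule k V & Lmodule_isBanach R k V }.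

Section ValuationField.
Context {R : realType} {k : completeValuationFieldType R}.
Implicit Types (x y : k).

Lemma vabs0 : vabs (0 : k) = 0. Proof. exact/vabs_eq0. Qed.

Lemma vabs1 : vabs (1 : k) = 1.
Proof.
have n0 : vabs (1 : k) != 0.
  by apply/eqP => /vabs_eq0 /eqP; rewrite oner_eq0.
by apply: (mulfI n0); rewrite -vabsM !mulr1.
Qed.

Lemma vabsN x : vabs (- x) = vabs x.
Proof.
have sq : vabs (-1 : k) ^+ 2 = 1 by rewrite expr2 -vabsM mulrNN mulr1 vabs1.
have -> : - x = -1 * x by rewrite mulN1r.
suff v1 : vabs (-1 : k) = 1 by rewrite vabsM v1 mul1r.
by apply/eqP; rewrite -(@pexpr_eq1 _ _ 2) ?vabs_ge0 // sq.
Qed.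

Lemma vabsBC x y : vabs (x - y) = vabs (y - x).
Proof. by rewrite -vabsN opprB. Qed.

Lemma vabs_ultra_le x y (c : R) :
  vabs x <= c -> vabs y <= c -> vabs (x + y) <= c.
Proof.
by move=> xc yc; rewrite (le_trans (vabs_ultra _ _))// ge_max xc yc.
Qed.

Lemma vabsB_le x y (c : R) : vabs x <= c -> vabs y <= c -> vabs (x - y) <= c.
Proof. by move=> xc yc; apply: vabs_ultra_le; rewrite ?vabsN. Qed.
End ValuationField.

Definition nontrivially_valued (R : realType)
    (k : completeValuationFieldType R) : Prop :=
  exists c : k, c != 0 /\ vabs c != 1.

Definition vclosed_ball (R : realType) (k : completeValuationFieldType R)
    (a : k) (r : R) : set k :=
  [set x | vabs (x - a) <= r].

Definition non_spherically_complete (R : realType)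
    (k : completeValuationFieldType R) : Prop :=
  exists (a : nat -> k) (r : nat -> R),
    [/\ forall n, 0 < r n,
        finI [set: nat] (fun n => vclosed_ball (a n) (r n)) &
        \bigcap_n vclosed_ball (a n) (r n) = set0].

Section ValuationRing.
Context {R : realType} (k : completeValuationFieldType R).

Definition valring_pred : pred k := fun c => vabs c <= 1.

Lemma valring_subring_closed : subring_closed valring_pred.
Proof.
split=> [|x y|x y]; rewrite -!topredE /= /valring_pred.
- by rewrite vabs1.
- exact: vabsB_le.
- by move=> x1 y1; rewrite vabsM mulr_ile1 ?vabs_ge0.
Qed.

HB.instance Definition _ :=
  GRing.isSubringClosed.Build k valring_pred valring_subring_closed.

Record valring : Type :=
  ValRing { valring_val :> k; valring_valP : valring_pred valring_val }.

HB.instance Definition _ := [isSub for valring_val].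
HB.instance Definition _ := [Choice of valring by <:].
HB.instance Definition _ := [SubChoice_isSubComNzRing of valring by <:].

Lemma valring_le1 (c : valring) : vabs (val c) <= 1.
Proof. exact: valring_valP. Qed.
End ValuationRing.

Section SupNorm.
Context {R : realType} {k : completeValuationFieldType R} {T : Type}.
Implicit Types f g : T -> k.

Definition vbounded f : Prop := exists C : R, forall t, vabs (f t) <= C.

(* For empty T this is sup set0 = 0. *)
Definition supnorm f : R := sup (range (fun t => vabs (f t))).

Lemma supnorm_ub f t : vbounded f -> vabs (f t) <= supnorm f.
Proof.
move=> [C fC]; apply: ub_le_sup; last by exists t.
by exists C => _ [s _ <-].
Qed.

Lemma supnorm_le f (C : R) :
  0 <= C -> (forall t, vabs (f t) <= C) -> supnorm f <= C.
Proof.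
move=> C0 fC; have [[t _]|T0] := pselect (exists t : T, True).
  by apply: ge_sup => [|_ [s _ <-]//]; exists (vabs (f t)), t.
suff r0 : range (fun t => vabs (f t)) = set0 by rewrite /supnorm r0 sup0.
by apply/seteqP; split=> // y [t _ _]; apply: T0; exists t.
Qed.

Lemma supnorm_ge0 f : 0 <= supnorm f.
Proof.
rewrite /supnorm; have [fb|fb] := pselect (has_sup (range (fun t => vabs (f t)))).
  have [[x [t _ _]] ub] := fb.
  by apply: le_trans (vabs_ge0 (f t)) _; apply: ub_le_sup => //; exists t.
by rewrite sup_out.
Qed.

Lemma supnorm_eq0 f : vbounded f -> supnorm f = 0 <-> f = (fun=> 0).
Proof.
move=> fb; split=> [f0|->].
  apply/funext => t; apply/vabs_eq0/eqP; rewrite eq_le vabs_ge0 andbT -f0.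
  exact: supnorm_ub.
by apply/eqP; rewrite eq_le supnorm_ge0 supnorm_le// => t; rewrite vabs0.
Qed.

Lemma supnormZ (c : k) f : vbounded f ->
  supnorm (fun t => c * f t) = vabs c * supnorm f.
Proof.
move=> fb; have cfle t : vabs (c * f t) <= vabs c * supnorm f.
  by rewrite vabsM ler_wpM2l ?vabs_ge0 ?supnorm_ub.
apply/eqP; rewrite eq_le supnorm_le ?mulr_ge0 ?vabs_ge0 ?supnorm_ge0//=.
have cfb : vbounded (fun t => c * f t) by exists (vabs c * supnorm f).
have [->|c0] := eqVneq c 0; first by rewrite vabs0 mul0r supnorm_ge0.
have vc0 : 0 < vabs c.
  by rewrite lt_def vabs_ge0 andbT; apply: contra_neq c0 => /vabs_eq0.
rewrite mulrC -ler_pdivlMr// supnorm_le ?divr_ge0 ?supnorm_ge0 ?vabs_ge0//.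
by move=> t; rewrite ler_pdivlMr// mulrC -vabsM (supnorm_ub t cfb).
Qed.

Lemma supnorm_ultra f g : vbounded f -> vbounded g ->
  supnorm (fun t => f t + g t) <= Num.max (supnorm f) (supnorm g).
Proof.
move=> fb gb; apply: supnorm_le => [|t]; first by rewrite le_max supnorm_ge0.
rewrite (le_trans (vabs_ultra _ _))// ge_max !le_max.
by rewrite !supnorm_ub// orbT.
Qed.

Lemma vboundedB f g : vbounded f -> vbounded g ->
  vbounded (fun t => f t - g t).
Proof.
move=> [C fC] [D gD]; exists (Num.max C D) => t.
by apply: vabsB_le; rewrite le_max ?fC ?gD ?orbT.
Qed.

Lemma supnorm_complete (u : nat -> T -> k) :
  (forall n, vbounded (u n)) ->
  dist_cauchy (fun f g => supnorm (fun t => f t - g t)) u ->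
  exists g : T -> k, forall e : R, 0 < e ->
    exists N, forall n, (N <= n)%N -> forall t, vabs (u n t - g t) <= e.
Proof.
move=> ub uC.
have uCt t : dist_cauchy (fun x y : k => vabs (x - y)) (fun n => u n t).
  move=> e /uC[N NC]; exists N => m n Nm Nn.
  exact: le_lt_trans (supnorm_ub t (vboundedB (ub m) (ub n))) (NC m n Nm Nn).
pose g t := projT1 (cid (vabs_complete _ (uCt t))).
have gP t := projT2 (cid (vabs_complete _ (uCt t))).
exists g => e e0; have [N NC] := uC e e0; exists N => n Nn t.
have [N' N'g] := gP t e e0; pose m := maxn N N'.
rewrite (_ : _ - _ = (u n t - u m t) + (u m t - g t)); last first.
  by rewrite addrA subrK.
apply: vabs_ultra_le.
  apply: le_trans (supnorm_ub t (vboundedB (ub n) (ub m))) _.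
  by apply/ltW/NC => //; exact: leq_maxl.
by apply/ltW/N'g; exact: leq_maxr.
Qed.
End SupNorm.

Section C0.
Context {R : realType} (I : Type) (k : completeValuationFieldType R).

Definition C0_pred : pred (I -> k^o) := fun f =>
  `[< forall e : R, 0 < e -> finite_set [set i | e <= vabs (f i : k)] >].

Lemma C0_submod_closed : submod_closed C0_pred.
Proof.
split=> [|c f g]; rewrite -!topredE /=.
  apply/asboolP => e e0; rewrite (_ : [set _ | _] = set0) ?finite_set0//.
  by apply/seteqP; split=> // i /=; rewrite vabs0 leNgt e0.
move=> /asboolP fP /asboolP gP; apply/asboolP => e e0.
have [->|c0] := eqVneq c 0; first by rewrite scale0r add0r; exact: gP.
have vc0 : 0 < vabs c.
  by rewrite lt_def vabs_ge0 andbT; apply: contra_neq c0 => /vabs_eq0.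
have ec : 0 < e / vabs c by rewrite divr_gt0.
have fin : finite_set ([set i | e / vabs c <= vabs (f i : k)] `|`
    [set i | e <= vabs (g i : k)]).
  by rewrite finite_setU; split; [exact: fP|exact: gP].
apply: sub_finite_set fin => i /= efg.
have := le_trans efg (vabs_ultra (c * f i) (g i)).
rewrite le_max vabsM => /orP[ef|]; [left|by right].
by rewrite ler_pdivrMr// mulrC.
Qed.

HB.instance Definition _ :=
  GRing.isSubmodClosed.Build k (I -> k^o) C0_pred C0_submod_closed.

Record C0 : Type := MkC0 { C0_fun :> I -> k^o; C0_funP : C0_pred C0_fun }.

HB.instance Definition _ := [isSub for C0_fun].
HB.instance Definition _ := [Choice of C0 by <:].
HB.instance Definition _ := [SubChoice_isSubLmodule of C0 by <:].

Definition C0_norm (f : C0) : R := supnorm (f : I -> k).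

Lemma C0_bounded (f : C0) : vbounded (f : I -> k).
Proof.
have /asboolP/(_ 1 ltr01)/(finite_image (fun i => vabs (f i : k))) := C0_funP f.
move=> /finite_seqP[s sE].
have [C CP] : exists C : R, {in s, forall x, x <= C}.
  elim: s {sE} => [|x s [C CP]]; first by exists 0.
  exists (Num.max x C) => y; rewrite inE le_max => /predU1P[->|/CP ->].
    by rewrite lexx.
  by rewrite orbT.
exists (Num.max 1 C) => i; rewrite le_max; have [//|/ltW f1] := leP _ 1.
apply: CP; have : [set` s] (vabs (f i : k)) by rewrite -sE; exists i.
by [].
Qed.

Lemma C0_norm_eq0 (f : C0) : C0_norm f = 0 <-> f = 0.
Proof.
rewrite /C0_norm (supnorm_eq0 (C0_bounded f)); split=> [f0|->//].
exact/val_inj.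
Qed.

Lemma C0_normZ (c : k) (f : C0) : C0_norm (c *: f) = vabs c * C0_norm f.
Proof. exact: supnormZ (C0_bounded f). Qed.

Lemma C0_norm_ultra (f g : C0) :
  C0_norm (f + g) <= Num.max (C0_norm f) (C0_norm g).
Proof. exact: supnorm_ultra (C0_bounded f) (C0_bounded g). Qed.

Lemma C0_complete : dist_complete (fun f g : C0 => C0_norm (f - g)).
Proof.
move=> u uC.
have [g gP] := supnorm_complete (fun n => C0_bounded (u n)) uC.
have gC : C0_pred g.
  apply/asboolP => e e0; have [|N /(_ N (leqnn N)) NP] := gP (e / 2).
    by rewrite divr_gt0.
  have /asboolP/(_ e e0) := C0_funP (u N); apply: sub_finite_set => i /= ge.
  rewrite leNgt; apply/negP => ue.
  have : e <= Num.max (vabs (u N i : k)) (e / 2).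
    apply: (le_trans ge); rewrite (_ : g i = u N i - (u N i - g i)).
      apply: vabsB_le; first by rewrite le_max lexx.
      by rewrite le_max NP orbT.
    by rewrite opprB addrC subrK.
  rewrite le_max leNgt ue/= leNgt ltr_pdivrMr// ltr_pMr//.
  by rewrite ltr1n.
exists (MkC0 gC) => e e0; have [|N NP] := gP (e / 2).
  by rewrite divr_gt0.
exists N => n /NP{}NP; apply: (@le_lt_trans _ _ (e / 2)).
  by apply: supnorm_le => //; rewrite divr_ge0// ltW.
by rewrite ltr_pdivrMr// ltr_pMr// ltr1n.
Qed.

HB.instance Definition _ := Lmodule_isBanach.Build R k C0
  (fun f => supnorm_ge0 (f : I -> k)) C0_norm_eq0 C0_normZ C0_norm_ultra
  C0_complete.
End C0.

(* The two duals denoted by the same superscript: unit_dual V is the O_k-module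
   of a Banach space V, bounded_dual M the Banach space of an O_k-module M. *)
Section UnitDual.
Context {R : realType} {k : completeValuationFieldType R} (V : banachType k).

Definition unit_dual_pred : pred (V -> k) := fun m =>
  `[< scalar m /\ forall v, vabs (m v) <= bnorm v >].

Lemma unit_dual_zmod_closed : zmod_closed unit_dual_pred.
Proof.
split=> [|f g]; rewrite -!topredE /=.
  apply/asboolP; split=> [c u v|v] /=; first by rewrite mulr0 addr0.
  by rewrite vabs0 bnorm_ge0.
move=> /asboolP[fl f1] /asboolP[gl g1]; apply/asboolP; split=> [c u v|v].
  by rewrite !fctE fl gl mulrBr opprD addrACA.
exact: vabsB_le.
Qed.

HB.instance Definition _ :=
  GRing.isZmodClosed.Build (V -> k) unit_dual_pred unit_dual_zmod_closed.

Record unit_dual : Type := UnitDual {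
  unit_dual_fun :> V -> k;
  unit_dual_funP : unit_dual_pred unit_dual_fun }.

HB.instance Definition _ := [isSub for unit_dual_fun].
HB.instance Definition _ := [Choice of unit_dual by <:].
HB.instance Definition _ := [SubChoice_isSubZmodule of unit_dual by <:].

Lemma unit_dual_linear (m : unit_dual) : scalar m.
Proof. by have /asboolP[] := unit_dual_funP m. Qed.

HB.instance Definition _ (m : unit_dual) :=
  GRing.isLinear.Build k V k *%R m (unit_dual_linear m).

Lemma unit_dual_le (m : unit_dual) v : vabs (m v) <= bnorm v.
Proof. by have /asboolP[] := unit_dual_funP m. Qed.

Lemma unit_dual_scale_subproof (c : valring k) (m : unit_dual) :
  unit_dual_pred (fun v => val c * m v).
Proof.
apply/asboolP; split=> [a u v|v]; first by rewrite linearP mulrDr mulrCA.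
rewrite vabsM (le_trans _ (unit_dual_le m v))//.
by rewrite ler_piMl ?vabs_ge0 ?valring_le1.
Qed.

Definition unit_dual_scale c m := UnitDual (unit_dual_scale_subproof c m).

Fact unit_dual_scaleA a b m :
  unit_dual_scale a (unit_dual_scale b m) = unit_dual_scale (a * b) m.
Proof. by apply/val_inj/funext => v /=; rewrite mulrA. Qed.

Fact unit_dual_scale1 : left_id 1 unit_dual_scale.
Proof. by move=> m; apply/val_inj/funext => v /=; rewrite mul1r. Qed.

Fact unit_dual_scaleDr : right_distributive unit_dual_scale +%R.
Proof. by move=> c m n; apply/val_inj/funext => v /=; rewrite -mulrDr. Qed.

Fact unit_dual_scaleDl m : {morph unit_dual_scale^~ m : a b / a + b}.
Proof. by move=> a b; apply/val_inj/funext => v /=; rewrite mulrDl. Qed.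

HB.instance Definition _ := GRing.Zmodule_isLmodule.Build (valring k) unit_dual
  unit_dual_scaleA unit_dual_scale1 unit_dual_scaleDr unit_dual_scaleDl.
End UnitDual.

Section BoundedDual.
Context {R : realType} {k : completeValuationFieldType R}.
Variable M : lmodType (valring k).

(* O_k-linearity of f : M -> k, where O_k acts on k through the inclusion. *)
Definition bounded_dual_pred : pred (M -> k^o) := fun f =>
  `[< GRing.linear_for (val \; *%R : valring k -> k -> k) f
      /\ vbounded (f : M -> k) >].

Lemma bounded_dual_submod_closed : submod_closed bounded_dual_pred.
Proof.
split=> [|c f g]; rewrite -!topredE /=.
  apply/asboolP; split=> [a u v|] /=; first by rewrite mulr0 addr0.
  by exists 0 => m; rewrite vabs0.
move=> /asboolP[fl fb] /asboolP[gl gb]; apply/asboolP; split=> [a u v|].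
  by rewrite !fctE fl gl /= scalerDr /GRing.scale /= mulrDr addrACA mulrCA.
exists (Num.max (vabs c * supnorm (f : M -> k)) (supnorm (g : M -> k))) => m.
apply: vabs_ultra_le; rewrite le_max ?vabsM.
  by rewrite ler_wpM2l ?vabs_ge0 ?supnorm_ub.
by rewrite supnorm_ub ?orbT.
Qed.

HB.instance Definition _ := GRing.isSubmodClosed.Build k (M -> k^o)
  bounded_dual_pred bounded_dual_submod_closed.

Record bounded_dual : Type := BoundedDual {
  bounded_dual_fun :> M -> k^o;
  bounded_dual_funP : bounded_dual_pred bounded_dual_fun }.

HB.instance Definition _ := [isSub for bounded_dual_fun].
HB.instance Definition _ := [Choice of bounded_dual by <:].
HB.instance Definition _ := [SubChoice_isSubLmodule of bounded_dual by <:].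

Lemma bounded_dual_linear (f : bounded_dual) :
  GRing.linear_for (val \; *%R : valring k -> k -> k) f.
Proof. by have /asboolP[] := bounded_dual_funP f. Qed.

HB.instance Definition _ (f : bounded_dual) :=
  GRing.isLinear.Build (valring k) M k (val \; *%R) f (bounded_dual_linear f).

Lemma bounded_dual_bounded (f : bounded_dual) : vbounded (f : M -> k).
Proof. by have /asboolP[] := bounded_dual_funP f. Qed.

Definition bounded_dual_norm (f : bounded_dual) : R := supnorm (f : M -> k).

Lemma bounded_dual_norm_eq0 f : bounded_dual_norm f = 0 <-> f = 0.
Proof.
rewrite /bounded_dual_norm (supnorm_eq0 (bounded_dual_bounded f)).
by split=> [f0|->//]; exact/val_inj.
Qed.

Lemma bounded_dual_normZ (c : k) f :
  bounded_dual_norm (c *: f) = vabs c * bounded_dual_norm f.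
Proof. exact: supnormZ (bounded_dual_bounded f). Qed.

Lemma bounded_dual_norm_ultra f g : bounded_dual_norm (f + g) <=
  Num.max (bounded_dual_norm f) (bounded_dual_norm g).
Proof.
exact: supnorm_ultra (bounded_dual_bounded f) (bounded_dual_bounded g).
Qed.

Lemma bounded_dual_complete :
  dist_complete (fun f g => bounded_dual_norm (f - g)).
Proof.
move=> u uC.
have [g gP] := supnorm_complete (fun n => bounded_dual_bounded (u n)) uC.
have gD : bounded_dual_pred g.
  apply/asboolP; split=> [a x y|].
    apply/eqP; rewrite -subr_eq0; apply/eqP/vabs_eq0/eqP.
    rewrite eq_le vabs_ge0 andbT; apply/ler_addgt0Pr => e e0; rewrite add0r.
    have [N /(_ N (leqnn N)) NP] := gP e e0.
    rewrite (_ : _ - _ = val a * (u N x - g x) + (u N y - g y)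
      - (u N (a *: x + y) - g (a *: x + y))).
      apply: vabsB_le => //; apply: vabs_ultra_le => //.
      rewrite vabsM (le_trans _ (NP x))//.
      by rewrite ler_piMl ?vabs_ge0 ?valring_le1.
    rewrite linearP /=. ring.
  have [N /(_ N (leqnn N)) NP] := gP 1 ltr01.
  exists (Num.max (supnorm (u N : M -> k)) 1) => m.
  rewrite (_ : g m = u N m - (u N m - g m)); last by rewrite opprB addrC subrK.
  apply: vabsB_le; rewrite le_max ?NP ?orbT//.
  by rewrite supnorm_ub//; exact: bounded_dual_bounded.
exists (BoundedDual gD) => e e0; have [|N NP] := gP (e / 2).
  by rewrite divr_gt0.
exists N => n /NP{}NP; apply: (@le_lt_trans _ _ (e / 2)).
  by apply: supnorm_le => //; rewrite divr_ge0// ltW.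
by rewrite ltr_pdivrMr// ltr_pMr// ltr1n.
Qed.

HB.instance Definition _ := Lmodule_isBanach.Build R k bounded_dual
  (fun f => supnorm_ge0 (f : M -> k)) bounded_dual_norm_eq0 bounded_dual_normZ
  bounded_dual_norm_ultra bounded_dual_complete.
End BoundedDual.

Section BanachBidual.
Context {R : realType} {k : completeValuationFieldType R} (V : banachType k).

Lemma banach_bidual_subproof (v : V) :
  bounded_dual_pred (fun m : unit_dual V => m v).
Proof.
apply/asboolP; split=> [c m n //|]; exists (bnorm v) => m.
exact: unit_dual_le.
Qed.

Definition banach_bidual (v : V) : bounded_dual (unit_dual V) :=
  BoundedDual (banach_bidual_subproof v).

Lemma banach_bidual_linear : linear banach_bidual.
Proof. by move=> c u v; apply/val_inj/funext => m /=; rewrite linearP. Qed.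

HB.instance Definition _ := GRing.isLinear.Build k V
  (bounded_dual (unit_dual V)) *:%R banach_bidual banach_bidual_linear.
End BanachBidual.

Section ModuleBidual.
Context {R : realType} {k : completeValuationFieldType R}.
Variable M : lmodType (valring k).

Lemma module_bidual_subproof (m : M) :
  unit_dual_pred (fun v : bounded_dual M => v m).
Proof.
apply/asboolP; split=> [c v w //|v].
exact: supnorm_ub (bounded_dual_bounded v).
Qed.

Definition module_bidual (m : M) : unit_dual (bounded_dual M) :=
  UnitDual (module_bidual_subproof m).

Lemma module_bidual_linear : linear module_bidual.
Proof. by move=> c m n; apply/val_inj/funext => v /=; rewrite linearP. Qed.

HB.instance Definition _ := GRing.isLinear.Build (valring k) M
  (unit_dual (bounded_dual M)) *:%R module_bidual module_bidual_linear.
End ModuleBidual.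

(* A set is uncountable iff its cardinality is at least aleph_1. *)
Definition non_measurable (I : Type) : Prop :=
  ~ (~ countable [set: I] /\
     exists U : set_system I,
       [/\ UltraFilter U,
           forall i, U <> principal_filter i &
           forall A : nat -> set I, (forall n, U (A n)) -> U (\bigcap_n A n)]).

Definition lmod_iso (A : pzRingType) (U V : lmodType A)
    (f : {linear U -> V}) : Prop := bijective f.

Definition isometric_iso (R : realType) (k : completeValuationFieldType R)
    (V W : banachType k) (f : {linear V -> W}) : Prop :=
  lmod_iso f /\ forall v, bnorm (f v) = bnorm v.

Definition free_banach (R : realType) (k : completeValuationFieldType R)
    (V : banachType k) : Prop :=
  exists2 I : Type, non_measurable I &
    exists f : {linear C0 I k -> V}, isometric_iso f.

Definition cofree_module (R : realType) (k : completeValuationFieldType R)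
    (M : lmodType (valring k)) : Prop :=
  exists2 I : Type, non_measurable I &
    exists f : {linear M -> (I -> (valring k)^o)}, lmod_iso f.

(* Main.v *)
Require Import Defs.
From HB Require Import structures.
From mathcomp Require Import all_boot all_order all_algebra.
From mathcomp Require Import boolp classical_sets functions cardinality filter.
From mathcomp Require Import finmap reals ring lra.

(**
Both halves of the theorem come from one bilinear pairing, between C_0(I,k)
and the cube O_k^I, sending (a, z) to the convergent sum of the a_i z_i
([pairing]).

Over every k this pairing identifies O_k^I with the unit dual of C_0(I,k):
finitely supported families are dense, so a functional m of norm at most 1 is
determined by the values m(e_i), which lie in O_k ([unit_dual_sums_to]).

The other direction, that every bounded functional f on O_k^I is the pairing
with some a in C_0(I,k), needs both hypotheses on k and I
([bounded_dual_cubeE]).  It has three stages.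

- On O_k^nat, a bounded functional killing all unit vectors is zero
  ([bounded_dual_nat_eq0]).  If not, failure of spherical completeness gives a
  sequence u in k with strictly decreasing steps and without pseudo-limit.  Up
  to a scalar, lift each step u_(n+1) - u_n to a multiple of a vector X_n at
  which f nearly attains its norm, and let y be the diagonal vector whose j-th
  coordinate is that of the j-th partial sum of the lifts.  The difference
  between y and the n-th partial sum is small outside finitely many
  coordinates, which f ignores; hence f(y) is a pseudo-limit of u, up to the
  scalar and a translation.
- The values f(e_i) tend to zero.  Otherwise one may rescale countably many
  coordinates so that all f(e_n) are equal to one scalar s <> 0; then f minus
  its composite with the shift kills all unit vectors, hence vanishes, while
  its value at the constant vector 1 is s
  ([nat_coefs_not_away_from_0]).  So the f(e_i) form an element a of C_0(I,k),
  and it remains to see that g = f - pairing a is zero.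
- Given e > 0, call A negligible if |g| <= e on vectors supported in A.  By the
  first two stages, negligible sets form a sigma-ideal, which contains the
  singletons, and there is no infinite disjoint family of non-negligible sets.
  If I itself were not negligible, halving could not go on forever, so there
  would be a non-negligible set A of which no subset splits it into two
  non-negligible parts; the B such that A minus B is negligible would form a
  non-principal ultrafilter closed under countable intersections
  ([sigma_ideal_full]).

A pairing with these two representation properties makes both canonical maps
into the double duals isomorphisms, and it can be transported along
isomorphisms on either side.
*)

Set Implicit Arguments.
Unset Strict Implicit.
Unset Printing Implicit Defensive.

Import Order.TTheory GRing.Theory Num.Theory.

Local Open Scope classical_set_scope.
Local Open Scope ring_scope.

(** * Absolute values *)

Section AbsoluteValue.
Context {R : realType} {k : completeValuationFieldType R}.

Lemma vabs_gt0 (c : k) : c != 0 -> 0 < vabs c.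
Proof.
by move=> c0; rewrite lt_def vabs_ge0 andbT; apply: contra_neq c0 => /vabs_eq0.
Qed.

Lemma vabsV (c : k) : vabs c^-1 = (vabs c)^-1.
Proof.
have [->|c0] := eqVneq c 0; first by rewrite invr0 vabs0 invr0.
apply: (mulfI (lt0r_neq0 (vabs_gt0 c0))).
by rewrite -vabsM divff// vabs1 divff// lt0r_neq0// vabs_gt0.
Qed.

Lemma vabsX (c : k) n : vabs (c ^+ n) = vabs c ^+ n.
Proof. by elim: n => [|n IHn]; rewrite ?expr0 ?vabs1// !exprS vabsM IHn. Qed.

Lemma vabs_sum_le (J : eqType) (s : seq J) (P : pred J) (g : J -> k) C :
  0 <= C -> (forall j, j \in s -> P j -> vabs (g j) <= C) ->
  vabs (\sum_(j <- s | P j) g j) <= C.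
Proof.
move=> C0 gC; rewrite big_seq_cond; elim/big_ind: _ => [|x y|j /andP[]].
- by rewrite vabs0.
- exact: vabs_ultra_le.
- exact: gC.
Qed.

Lemma vabs_small (e : R) : nontrivially_valued k -> 0 < e ->
  exists2 c : k, c != 0 & vabs c <= e.
Proof.
move=> [c [c0 c1]] e0.
wlog cgt1 : c c0 c1 / 1 < vabs c.
  move=> H; have [cgt|clt|/eqP] := ltgtP 1 (vabs c); last by rewrite eq_sym (negPf c1).
    exact: H cgt.
  have cVgt : 1 < vabs c^-1 by rewrite vabsV invf_gt1 ?vabs_gt0.
  by apply: (H c^-1); rewrite ?invr_eq0 ?(gt_eqF cVgt).
have [h h0 cE] : exists2 h : R, 0 < h & vabs c = 1 + h.
  by exists (vabs c - 1); rewrite ?subr_gt0// addrC subrK.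
have bern n : n%:R * h <= (1 + h) ^+ n.
  suff : n%:R * h + 1 <= (1 + h) ^+ n by apply: le_trans; rewrite lerDl.
  elim: n => [|n IHn]; first by rewrite mul0r add0r expr0.
  rewrite exprS; apply: (@le_trans _ _ ((1 + h) * (n%:R * h + 1))).
    have nh : 0 <= n%:R * (h * h) by rewrite !mulr_ge0// ltW.
    by rewrite -natr1; nra.
  by rewrite ler_wpM2l// addr_ge0// ltW.
(* Bernoulli's inequality makes the powers of 1 + h unbounded. *)
pose n := Num.bound (e^-1 / h).
exists (c ^+ n)^-1; first by rewrite invr_eq0 expf_neq0.
rewrite vabsV vabsX cE -[e]invrK lef_pV2 ?posrE ?invr_gt0 ?exprn_gt0 ?addr_gt0//.
apply: le_trans (bern n); rewrite -ler_pdivrMr//; apply/ltW/archi_boundP.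
by apply: divr_ge0; rewrite ?invr_ge0 ltW.
Qed.

Lemma val_sum (J : Type) (r : seq J) (F : J -> (valring k)^o) :
  val (\sum_(i <- r) F i) = \sum_(i <- r) val (F i).
Proof. by elim/big_rec2: _ => // i x y _ <-. Qed.

End AbsoluteValue.

(** * Unordered sums over a complete valuation field *)

Section Summation.
Context {R : realType} {k : completeValuationFieldType R} {I : choiceType}.
Implicit Types (g h : I -> k) (l m c : k) (e C : R).

(** The sums over finite sets of indices converge to l along the directed set of
    finite sets; finite sets are coded as duplicate-free sequences. *)
Definition sums_to g l := forall e, 0 < e -> exists s : seq I,
  forall t, uniq t -> {subset s <= t} -> vabs (l - \sum_(i <- t) g i) <= e.

Lemma sums_to_unique g l m : sums_to g l -> sums_to g m -> l = m.
Proof.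
move=> gl gm; apply/eqP; rewrite -subr_eq0; apply/eqP/vabs_eq0/eqP.
rewrite eq_le vabs_ge0 andbT; apply/ler_addgt0Pr => e e0; rewrite add0r.
have [s sP] := gl e e0; have [s' s'P] := gm e e0.
pose t := undup (s ++ s').
have st : {subset s <= t} by move=> i si; rewrite mem_undup mem_cat si.
have s't : {subset s' <= t} by move=> i si; rewrite mem_undup mem_cat si orbT.
rewrite (_ : l - m = (l - \sum_(i <- t) g i) - (m - \sum_(i <- t) g i)).
  by apply: vabsB_le; [apply: sP|apply: s'P] => //; apply: undup_uniq.
ring.
Qed.

Lemma sums_to_linear c g h l m : sums_to g l -> sums_to h m ->
  sums_to (fun i => c * g i + h i) (c * l + m).
Proof.
move=> gl hm e e0; have c1 : 0 < vabs c + 1 by rewrite ltr_wpDl// vabs_ge0.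
have [s sP] := gl (e / (vabs c + 1)) (divr_gt0 e0 c1).
have [s' s'P] := hm e e0; exists (s ++ s') => t tu st.
have {}sP : vabs (l - \sum_(i <- t) g i) <= e / (vabs c + 1).
  by apply: sP => // i si; apply: st; rewrite mem_cat si.
have {}s'P : vabs (m - \sum_(i <- t) h i) <= e.
  by apply: s'P => // i si; apply: st; rewrite mem_cat si orbT.
rewrite big_split -mulr_sumr /=.
rewrite (_ : _ - _ = c * (l - \sum_(i <- t) g i) + (m - \sum_(i <- t) h i)).
  apply: vabs_ultra_le => //; rewrite vabsM.
  apply: (@le_trans _ _ ((vabs c + 1) * (e / (vabs c + 1)))).
    by rewrite ler_pM ?vabs_ge0// lerDl.
  by rewrite mulrC divfK ?gt_eqF.
ring.
Qed.

Lemma sums_to_le g l C :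
  0 <= C -> (forall i, vabs (g i) <= C) -> sums_to g l -> vabs l <= C.
Proof.
move=> C0 gC gl; apply/ler_addgt0Pr => e e0; have [s sP] := gl e e0.
rewrite -[l](subrK (\sum_(i <- undup s) g i)); apply: vabs_ultra_le.
  rewrite (le_trans (sP _ (undup_uniq s) _)) ?lerDr// => i.
  by rewrite mem_undup.
by rewrite vabs_sum_le ?addr_ge0 ?(ltW e0)// => i _ _; rewrite ler_wpDr ?(ltW e0).
Qed.

Lemma sums_to_finite g (s : seq I) : uniq s -> (forall i, i \notin s -> g i = 0) ->
  sums_to g (\sum_(i <- s) g i).
Proof.
move=> su gs e e0; exists s => t tu st.
suff -> : \sum_(i <- t) g i = \sum_(i <- s) g i by rewrite subrr vabs0 ltW.
rewrite (bigID (mem s))/= [X in _ + X]big1 ?addr0; last by move=> i; apply: gs.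
rewrite -big_filter; apply: perm_big; apply: uniq_perm; rewrite ?filter_uniq//.
move=> i; rewrite mem_filter; apply: andb_idr; exact: st.
Qed.

(** In an ultrametric field a family tending to zero is summable: the partial
    sums over the finite sets where g is at least 1/(n+1) form a Cauchy sequence. *)
Lemma C0_sums_to g : C0_pred g -> exists l, sums_to g l.
Proof.
move=> /asboolP gC.
have invS n : 0 < (n.+1%:R^-1 : R) by rewrite invr_gt0.
have fin n : exists s : seq I, uniq s /\ forall i, i \notin s ->
    vabs (g i) <= n.+1%:R^-1.
  have /finite_seqP[s sE] := gC _ (invS n).
  exists (undup s); split=> [|i]; first exact: undup_uniq.
  rewrite mem_undup => /negP si; rewrite leNgt; apply/negP => /ltW gi; apply: si.
  by have : [set` s] i by rewrite -sE.
have [s /all_and2[su sP]] := choice fin.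
pose u n := \sum_(i <- s n) g i.
have tail n t : uniq t -> {subset s n <= t} ->
    vabs (\sum_(i <- t) g i - u n) <= n.+1%:R^-1.
  move=> tu st; have -> : u n = \sum_(i <- t | i \in s n) g i.
    rewrite /u -[RHS]big_filter; apply/perm_big/uniq_perm; rewrite ?filter_uniq//.
    by move=> i; rewrite mem_filter andb_idr//; apply: st.
  rewrite (bigID (mem (s n)))/= addrAC subrr add0r.
  by apply: vabs_sum_le => [|i _]; [exact: ltW|exact: sP].
have small e : 0 < e -> exists N, forall n, (N <= n)%N -> n.+1%:R^-1 < e.
  move=> e0; have [N NP] : exists N, e^-1 < N.+1%:R.
    exists (Num.bound e^-1); apply: lt_trans (archi_boundP _) _.
      by rewrite invr_ge0 ltW.
    by rewrite ltr_nat.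
  exists N => n Nn; rewrite -[e]invrK ltf_pV2 ?posrE ?invr_gt0//.
  by apply: lt_le_trans NP _; rewrite ler_nat.
have close n (m : nat) : (n <= m)%N -> vabs (u m - u n) <= n.+1%:R^-1.
  move=> nm; pose t := undup (s n ++ s m).
  have -> : u m - u n = (\sum_(i <- t) g i - u n) - (\sum_(i <- t) g i - u m).
    ring.
  apply: vabsB_le.
    by apply: tail; rewrite ?undup_uniq// => i si; rewrite mem_undup mem_cat si.
  apply: le_trans (tail m t _ _) _; rewrite ?undup_uniq//.
    by move=> i si; rewrite mem_undup mem_cat si orbT.
  by rewrite lef_pV2 ?posrE// ler_nat.
have [l lP] : exists l, dist_cvg (fun x y : k => vabs (x - y)) u l.
  apply: vabs_complete => e e0; have [N NP] := small e e0; exists N => m n Nm Nn.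
  have [nm|/ltnW mn] := leqP n m.
    exact: le_lt_trans (close n m nm) (NP n Nn).
  by rewrite vabsBC; exact: le_lt_trans (close m n mn) (NP m Nm).
exists l => e e0; have [N NP] := small e e0; have [N' N'P] := lP e e0.
pose n := maxn N N'; exists (s n) => t tu st.
have -> : l - \sum_(i <- t) g i = - (u n - l) - (\sum_(i <- t) g i - u n) by ring.
apply: vabsB_le; first by rewrite vabsN ltW// N'P ?leq_maxr.
by apply: le_trans (tail n t tu st) _; rewrite ltW// NP ?leq_maxl.
Qed.

End Summation.

(** * The pairing of null families with the cube *)

Local Notation unit_cube I k := (I -> (valring k)^o).

Section Pairing.
Context {R : realType} {k : completeValuationFieldType R} {I : choiceType}.
Implicit Types (a b : C0 I k) (z w : unit_cube I k) (m : unit_dual (C0 I k)).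

Definition cube_unit (i : I) : unit_cube I k := fun j => (j == i)%:R.

Lemma val_cube_unit (i j : I) : val (cube_unit i j) = (j == i)%:R :> k.
Proof. by rewrite /cube_unit; case: eqP. Qed.

Lemma C0_unit_subproof (i : I) : C0_pred (fun j => (j == i)%:R : k^o).
Proof.
apply/asboolP => e e0; apply: (@sub_finite_set _ _ [set i]) => // j /=.
by case: eqP => //= _; rewrite vabs0 leNgt e0.
Qed.

Definition C0_unit i : C0 I k := MkC0 (C0_unit_subproof i).

Lemma C0_mul_sums_to a z : exists l, sums_to (fun i => a i * val (z i)) l.
Proof.
apply: C0_sums_to; apply/asboolP => e e0.
have /asboolP/(_ e e0) := C0_funP a; apply: sub_finite_set => i /= ei.
apply: le_trans ei _; rewrite vabsM ler_piMr ?vabs_ge0//; exact: valring_le1.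
Qed.

Definition pairing a z : k := xget 0 (sums_to (fun i => a i * val (z i))).

Lemma pairingP a z : sums_to (fun i => a i * val (z i)) (pairing a z).
Proof. by have := xgetPex 0 (C0_mul_sums_to a z). Qed.

Lemma pairingE a z l : sums_to (fun i => a i * val (z i)) l -> pairing a z = l.
Proof. exact: sums_to_unique (pairingP a z). Qed.

Lemma pairing_linearl z : scalar (pairing^~ z).
Proof.
move=> c a b; apply: pairingE.
have := sums_to_linear c (pairingP a z) (pairingP b z).
by congr sums_to; apply/funext => i; rewrite mulrA -mulrDl.
Qed.

Lemma pairing_linearr a :
  GRing.linear_for (val \; *%R : valring k -> k -> k) (pairing a).
Proof.
move=> c z w; apply: pairingE.
have := sums_to_linear (val c) (pairingP a z) (pairingP a w).
congr sums_to; apply/funext => i /=.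
by rewrite mulrDr mulrCA.
Qed.

Lemma pairing_le a z C : 0 <= C -> (forall i, vabs (a i : k) <= C) ->
  vabs (pairing a z) <= C.
Proof.
move=> C0 aC; apply: sums_to_le C0 _ (pairingP a z) => i.
apply: le_trans (aC i); rewrite vabsM ler_piMr ?vabs_ge0//; exact: valring_le1.
Qed.

Lemma pairing_norm a z : vabs (pairing a z) <= bnorm a.
Proof.
apply: pairing_le (bnorm_ge0 a) _ => i; exact: supnorm_ub (C0_bounded a).
Qed.

Lemma pairing_cube_unit a i : pairing a (cube_unit i) = a i.
Proof.
apply: pairingE; rewrite -[l in sums_to _ l](_ : \sum_(j <- [:: i]) a j * val (cube_unit i j) = _).
  apply: sums_to_finite => // j; rewrite inE val_cube_unit => /negPf ->.
  by rewrite mulr0.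
by rewrite big_seq1 val_cube_unit eqxx mulr1.
Qed.

Lemma pairing_C0_unit i z : pairing (C0_unit i) z = val (z i).
Proof.
apply: pairingE; rewrite -[l in sums_to _ l](_ : \sum_(j <- [:: i]) C0_unit i j * val (z j) = _).
  by apply: sums_to_finite => // j; rewrite inE /= => /negPf ->; rewrite mul0r.
by rewrite big_seq1/= eqxx mul1r.
Qed.

Lemma C0_unit_norm i : bnorm (C0_unit i) <= 1.
Proof. by apply: supnorm_le => // j /=; case: eqP; rewrite ?vabs1 ?vabs0. Qed.

Lemma C0_coord_sum (J : Type) (s : seq J) (F : J -> C0 I k) j :
  (\sum_(i <- s) F i) j = \sum_(i <- s) F i j.
Proof. by elim/big_rec2: _ => // i x y _ <-. Qed.

Lemma C0_unitZ (c : k) i j : (c *: C0_unit i) j = c * (j == i)%:R.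
Proof. by []. Qed.

Lemma C0_truncE a (t : seq I) j : uniq t ->
  (\sum_(i <- t) a i *: C0_unit i) j = if j \in t then a j else 0.
Proof.
move=> tu; rewrite C0_coord_sum; case: ifPn => jt.
  rewrite (bigD1_seq j jt tu) C0_unitZ eqxx mulr1 big1 ?[LHS]addr0//.
  by move=> i /negPf ij; rewrite C0_unitZ eq_sym ij mulr0.
rewrite big_seq big1// => i it.
by rewrite C0_unitZ; case: eqP it jt => [->->//|_ _ _]; rewrite mulr0.
Qed.

(** The finite truncations of a converge to a in norm, so the continuous map m
    may be computed term by term. *)
Lemma unit_dual_sums_to m a : sums_to (fun i => a i * m (C0_unit i)) (m a).
Proof.
move=> e e0; have /asboolP/(_ e e0)/finite_seqP[s sE] := C0_funP a.
exists s => t tu st.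
have -> : \sum_(i <- t) a i * m (C0_unit i) = m (\sum_(i <- t) a i *: C0_unit i).
  by rewrite linear_sum; apply: eq_bigr => i _; rewrite linearZ.
rewrite -linearB; apply: le_trans (unit_dual_le _ _) _.
apply: supnorm_le => [|j]; first exact: ltW.
rewrite [X in vabs X](_ : _ = a j - (\sum_(i <- t) a i *: C0_unit i) j)//.
rewrite C0_truncE//; case: ifPn => [_|jt]; first by rewrite subrr vabs0 ltW.
rewrite subr0 ltW// ltNge; apply/negP => ej; move/negP: jt; apply; apply: st.
by have : [set` s] j by rewrite -sE.
Qed.

Lemma cube_of_subproof m i : valring_pred (m (C0_unit i)).
Proof. exact: le_trans (unit_dual_le _ _) (C0_unit_norm i). Qed.

Definition cube_of m : unit_cube I k := fun i => ValRing (cube_of_subproof m i).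

Lemma pairing_cube_of m a : pairing a (cube_of m) = m a.
Proof. exact/pairingE/unit_dual_sums_to. Qed.

Lemma pairing_bounded a : bounded_dual_pred (pairing a).
Proof.
apply/asboolP; split; first exact: pairing_linearr.
by exists (bnorm a); apply: pairing_norm.
Qed.

Definition pairing_functional a : bounded_dual (unit_cube I k) :=
  BoundedDual (pairing_bounded a).

End Pairing.

(** * Pseudo-Cauchy sequences without pseudo-limit *)

Section PseudoCauchy.
Context {R : realType} {k : completeValuationFieldType R}.

(** From centers c_n of the first n+1 balls, pass to a subsequence s such that
    c_(s n) lies outside the ball number s(n+1), which contains all later
    centers: then each step exceeds the radius of that ball and the next one
    does not.  Using steps instead of radii keeps all distances in the value
    group, so that they can be scaled by elements of k. *)
Lemma pseudo_cauchy_seq : non_spherically_complete k ->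
  exists u : nat -> k,
    (forall n, vabs (u n.+2 - u n.+1) < vabs (u n.+1 - u n)) /\
    (forall l, exists n, vabs (u n.+1 - u n) < vabs (l - u n)).
Proof.
move=> [a [r [_ rfin r0]]]; pose B n := vclosed_ball (a n) (r n).
have inB n x y : B n x -> B n y -> vabs (x - y) <= r n.
  move=> Bx By; rewrite (_ : x - y = (x - a n) - (y - a n)); last by ring.
  exact: vabsB_le.
have Bin n x y : B n x -> vabs (y - x) <= r n -> B n y.
  move=> Bx yx; rewrite /B /vclosed_ball /=.
  by rewrite -(subrK x y) -addrA; exact: vabs_ultra_le.
have /choice[c cB] n : exists x, forall i, (i <= n)%N -> B i x.
  have [i _|x xB] := rfin [fset i in iota 0 n.+1]%fset; first exact: in_setT.
  by exists x => -[|i] ni; apply: xB; rewrite /= !inE mem_iota ?add1n ?ltnS ?ni.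
have /choice[nx nxB] n : exists i, ~ B i (c n).
  apply: contrapT => nB; suff : (\bigcap_n B n) (c n) by rewrite r0.
  by move=> i _; apply: contrapT => Bi; apply: nB; exists i.
have nx_gt n : (n < nx n)%N.
  by rewrite ltnNge; apply/negP => /cB/nxB.
pose s n := iter n nx 0%N.
have s_mono n m : (n <= m)%N -> (s n <= s m)%N.
  move=> /subnK <-; elim: (m - n)%N => // d IHd.
  by rewrite addSn (leq_trans IHd)// /s /= ltnW.
have s_ge n : (n <= s n)%N.
  by elim: n => // n IHn; rewrite (leq_ltn_trans IHn)// nx_gt.
exists (c \o s); split=> [n|l] /=.
  apply: (@le_lt_trans _ _ (r (s n.+1))).
    by apply: inB; apply: cB => //; exact: (s_mono n.+1 n.+2).
  rewrite vabsBC ltNge; apply/negP => /Bin lt; apply: (nxB (s n)).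
  by apply: lt; apply: cB.
apply: contrapT => lP; suff : (\bigcap_n B n) l by rewrite r0.
move=> i _; apply: (Bin i (c (s i))); first exact/cB/s_ge.
have : vabs (l - c (s i)) <= vabs (c (s i.+1) - c (s i)).
  by rewrite leNgt; apply/negP => li; apply: lP; exists i.
move=> /le_trans; apply; apply: inB; apply: cB; last exact: s_ge.
exact: leq_trans (s_ge i) (s_mono _ _ (leqnSn i)).
Qed.

End PseudoCauchy.

(** * Bounded functionals on the cube *)

Section Cube.
Context {R : realType} {k : completeValuationFieldType R}.

Lemma bounded_dual_comp (M N : lmodType (valring k)) (f : bounded_dual N)
  (h : M -> N) : linear h -> bounded_dual_pred (f \o h).
Proof.
move=> hl; apply/asboolP; split=> [c x y|] /=.
  by rewrite hl linearP.
by have [C fC] := bounded_dual_bounded f; exists C => x; exact: fC.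
Qed.

(** Pulling back along these maps reduces questions about countably many
    disjoint parts of I to the index set nat. *)
Definition gather (I J : Type) (p : I -> J) (y : unit_cube I k)
  (z : unit_cube J k) : unit_cube I k := fun i => z (p i) * y i.

Lemma gather_linear (I J : Type) (p : I -> J) (y : unit_cube I k) :
  linear (gather p y).
Proof. by move=> c z w; apply/funext => i; rewrite /gather mulrDl -mulrA. Qed.

(** The bound is scaled by an element of k and not by an arbitrary real, since
    z can only be divided by scalars. *)
Lemma bounded_dual_scaled_le (I : Type) (f : bounded_dual (unit_cube I k))
    (c : valring k) (z : unit_cube I k) (C : R) :
  (forall w, vabs (f w) <= C) ->
  (forall i, vabs (val (z i)) <= vabs (val c)) ->
  vabs (f z) <= vabs (val c) * C.
Proof.
move=> fC zc; have zcP i : valring_pred (val (z i) / val c).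
  have [/eqP c0|c0] := eqVneq (val c) 0.
    by rewrite /valring_pred (eqP c0) invr0 mulr0 vabs0.
  rewrite /valring_pred -(ler_pM2r (vabs_gt0 c0)) -vabsM divfK// mul1r; exact: zc.
have -> : z = c *: (fun i => ValRing (zcP i) : (valring k)^o).
  apply/funext => i; apply/val_inj => /=.
  have [c0|c0] := eqVneq (val c) 0; last by rewrite mulrC divfK.
  rewrite [val c]c0 mul0r; apply/vabs_eq0/eqP; rewrite eq_le vabs_ge0 andbT.
  by rewrite (le_trans (zc i))// c0 vabs0.
by rewrite linearZ /= vabsM ler_wpM2l ?vabs_ge0.
Qed.

End Cube.

Section NatCube.
Context {R : realType} {k : completeValuationFieldType R}.
Implicit Types (f : bounded_dual (unit_cube nat k)).

(** A functional that kills the unit vectors only sees the tail of z. *)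
Lemma bounded_dual_tail_le f (c : valring k) (C : R) :
  (forall w, vabs (f w) <= C) -> (forall n, f (cube_unit n) = 0) ->
  forall n z, (forall i, (n <= i)%N -> vabs (val (z i)) <= vabs (val c)) ->
  vabs (f z) <= vabs (val c) * C.
Proof.
move=> fC f0; elim=> [|n IHn] z zc.
  by apply: bounded_dual_scaled_le => // i; exact: zc.
have -> : f z = f (z - z n *: cube_unit n).
  by rewrite linearB linearZ /= f0 mulr0 subr0.
apply: IHn => i; rewrite leq_eqVlt => /predU1P[<-|ni].
  rewrite [X in val X](_ : _ = z n - z n * cube_unit n n)//.
  by rewrite /cube_unit eqxx mulr1 subrr vabs0 vabs_ge0.
rewrite [X in val X](_ : _ = z i - z n * cube_unit n i)//.
by rewrite /cube_unit gtn_eqF// mulr0 subr0; exact: zc.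
Qed.

(** If f is not zero, then f(y), for the diagonal vector y below, rescales to a
    pseudo-limit of a sequence that has none.  The delicate point is to lose
    nothing in the estimates: f(X_(n+1)) is chosen so close to the norm of f
    that the loss is absorbed by the strict decrease of the steps. *)
Lemma bounded_dual_nat_eq0 f : non_spherically_complete k ->
  (forall n, f (cube_unit n) = 0) -> forall z, f z = 0.
Proof.
move=> /pseudo_cauchy_seq[u [u_decr u_nolim]] f0 x; apply: contrapT => /eqP fx0.
pose L := supnorm (f : _ -> k).
have fL w : vabs (f w) <= L by apply: supnorm_ub (bounded_dual_bounded f).
have L0 : 0 < L by apply: lt_le_trans (fL x); exact: vabs_gt0.
pose b n := u n.+1 - u n.
have b_gt0 n : 0 < vabs (b n) by apply: le_lt_trans (u_decr n); exact: vabs_ge0.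
have b0 n : b n != 0.
  by apply: contraTneq (b_gt0 n) => ->; rewrite vabs0 ltxx.
have /choice[Y Ybig] n : exists w, L * vabs (b n.+1) <= vabs (f w) * vabs (b n).
  apply: contrapT => nw.
  have : L <= L * vabs (b n.+1) / vabs (b n).
    apply: supnorm_le => [|w].
      by rewrite !mulr_ge0 ?invr_ge0 ?vabs_ge0// ltW.
    rewrite ler_pdivlMr//; apply/ltW; rewrite ltNge; apply/negP => w_big.
    by apply: nw; exists w.
  by rewrite ler_pdivlMr// ler_pM2l// leNgt u_decr.
pose X n := if n is n'.+1 then Y n' else x.
have fX_gt0 n : 0 < vabs (f (X n)).
  case: n => [|n] /=; first exact: vabs_gt0.
  rewrite -(pmulr_lgt0 _ (b_gt0 n)); apply: lt_le_trans (Ybig n).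
  exact: mulr_gt0.
have fX0 n : f (X n) != 0.
  by apply: contraTneq (fX_gt0 n) => ->; rewrite vabs0 ltxx.
(* The scalar s makes c 0 = 1, so that all c n lie in the valuation ring. *)
pose s := f x / b 0%N.
have s0 : s != 0 by rewrite mulf_neq0 ?invr_eq0.
pose c n := s * b n / f (X n).
have cfX n : c n * f (X n) = s * b n by rewrite divfK.
have vcE n : vabs (c n) * vabs (f (X n)) = vabs s * vabs (b n).
  by rewrite -!vabsM cfX.
have c_small n : vabs (c n.+1) * L <= vabs s * vabs (b n).
  rewrite -(ler_pM2r (b_gt0 n.+1)) -mulrA [leRHS]mulrAC -vcE -[leRHS]mulrA.
  by rewrite ler_wpM2l ?vabs_ge0//; exact: Ybig.
have c_decr n : vabs (c n.+1) <= vabs (c n).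
  rewrite -(ler_pM2r L0) (le_trans (c_small n))// -vcE.
  by rewrite ler_wpM2l ?vabs_ge0.
have c_mono n i : (n <= i)%N -> vabs (c i) <= vabs (c n).
  move=> /subnK <-; elim: (i - n)%N => // d IHd; exact: le_trans (c_decr _) IHd.
have cO n : valring_pred (c n).
  rewrite /valring_pred (le_trans (c_mono 0%N n (leq0n n)))//.
  by rewrite /c /s divfK// divff// vabs1.
pose cc n := ValRing (cO n).
pose y : unit_cube nat k := fun j => \sum_(0 <= i < j) cc i * X i j.
pose S n : unit_cube nat k := \sum_(0 <= i < n) (cc i *: X i).
have fS n : f (S n) = s * (u n - u 0%N).
  rewrite /S linear_sum -(telescope_sumr u (leq0n n)) mulr_sumr.
  by apply: eq_bigr => i _; rewrite linearZ /= cfX.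
have SE n j : S n j = \sum_(0 <= i < n) cc i * X i j.
  by rewrite /S; elim/big_rec2: _ => // i ? ? _ <-.
have fyS n : vabs (f y - s * (u n - u 0%N)) <= vabs (c n) * L.
  rewrite -fS -linearB; apply: (@bounded_dual_tail_le f (cc n) L _ _ n) => // j nj.
  rewrite [X in val X](_ : _ = y j - S n j)// SE /y (big_cat_nat (leq0n n) nj).
  rewrite /= addrAC subrr add0r val_sum.
  rewrite big_seq; apply: vabs_sum_le => [|i _]; first exact: vabs_ge0.
  rewrite mem_index_iota => /andP[ni _]; rewrite rmorphM vabsM.
  rewrite (le_trans (ler_piMr _ _))// ?vabs_ge0 ?valring_le1//; exact: c_mono.
(* fyS at n.+1 puts the candidate within |b n| of u n.+1, and u n.+1 is itself
   at distance |b n| from u n. *)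
have [n] := u_nolim (f y / s + u 0%N); apply/negP; rewrite -leNgt.
rewrite (_ : _ - u n = f y / s + u 0%N - u n.+1 + b n); last by rewrite /b; ring.
apply: vabs_ultra_le => //; rewrite -(ler_pM2l (vabs_gt0 s0)) -vabsM.
rewrite (_ : s * _ = f y - s * (u n.+1 - u 0%N)).
  exact: le_trans (fyS _) (c_small n).
by rewrite mulrBr mulrDr mulrCA divff// mulr1; ring.
Qed.

End NatCube.

(** * The coefficients of a bounded functional *)

Section Coefficients.
Context {R : realType} {k : completeValuationFieldType R}.
Hypothesis (hk : nontrivially_valued k) (nsc : non_spherically_complete k).

(** Weighting the coordinates by u makes all coefficients equal to s; delta is
    the weighted difference with the shift, so f \o delta kills every unit
    vector, although delta maps the constant vector 1 to u_0 e_0. *)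
Lemma nat_coefs_not_away_from_0 (f : bounded_dual (unit_cube nat k)) (e : R) :
  0 < e -> ~ (forall n, e <= vabs (f (cube_unit n))).
Proof.
move=> e0 fe; have [s s0 se] := vabs_small hk e0.
have fn0 n : f (cube_unit n) != 0.
  by apply: contraTneq (fe n) => ->; rewrite vabs0 -ltNge.
have sO n : valring_pred (s / f (cube_unit n)).
  rewrite /valring_pred vabsM vabsV ler_pdivrMr ?vabs_gt0// mul1r.
  exact: le_trans se (fe n).
pose u n := ValRing (sO n).
pose delta (z : unit_cube nat k) : unit_cube nat k :=
  fun n => u n * (z n - if n is n'.+1 then z n' else 0).
have delta_lin : linear delta.
  move=> c z w; apply/funext => -[|n]; rewrite /delta.
    rewrite [RHS](_ : _ = c * (u 0%N * (z 0%N - 0)) + u 0%N * (w 0%N - 0))//.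
    by rewrite [LHS](_ : _ = u 0%N * (c * z 0%N + w 0%N - 0))//; ring.
  rewrite [RHS](_ : _ = c * (u n.+1 * (z n.+1 - z n)) + u n.+1 * (w n.+1 - w n))//.
  rewrite [LHS](_ : _ = u n.+1 * ((c * z n.+1 + w n.+1) - (c * z n + w n)))//.
  ring.
pose g := BoundedDual (bounded_dual_comp f delta_lin).
have g0 n : g (cube_unit n) = 0.
  rewrite /= (_ : delta _ = u n *: cube_unit n - u n.+1 *: cube_unit n.+1).
    have fZ i : f (u i *: cube_unit i) = s by rewrite linearZ /= divfK.
    by rewrite linearB /= !fZ subrr.
  apply/funext => j; rewrite [RHS](_ : _ = u n * cube_unit n j - u n.+1 * cube_unit n.+1 j)//.
  rewrite /delta /cube_unit; case: j => [|j].
    by case: n => [|n]; rewrite !(mulr0, subr0, mulr1).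
  rewrite eqSS mulrBr; congr (_ - _).
    by case: eqP => [->|]; rewrite ?mulr0.
  by case: eqP => [->|]; rewrite ?mulr0.
have := bounded_dual_nat_eq0 nsc g0 (fun=> 1).
rewrite /= (_ : delta _ = u 0%N *: cube_unit 0%N).
  by rewrite linearZ /= divfK// => /eqP; rewrite (negPf s0).
apply/funext => -[|n]; rewrite /delta ?subr0 ?subrr ?mulr0//.
by rewrite [RHS](_ : _ = u 0%N * 0)// mulr0.
Qed.

Section AnyIndex.
Context {I : choiceType}.
Implicit Types (f : bounded_dual (unit_cube I k)) (z w : unit_cube I k).
Implicit Types (A B : set I).

Definition cut A z : unit_cube I k := fun i => if `[< A i >] then z i else 0.

(** Gluing the y_n along the disjoint sets B_n pulls f back to a functional on
    the cube over nat whose n-th coefficient is the value of f at y_n cut down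
    to B_n. *)
Lemma cut_disjoint_not_away_from_0 f (e : R) (B : nat -> set I)
    (y : nat -> unit_cube I k) : 0 < e -> trivIset setT B ->
  ~ (forall n, e <= vabs (f (cut (B n) (y n)))).
Proof.
move=> e0 tB fe; pose p i : nat := xget 0%N [set n | B n i].
have pB n i : B n i -> p i = n.
  move=> Bi; apply: (tB _ _ Logic.I Logic.I); exists i; split=> //.
  exact: (@xgetPex _ 0%N [set n | B n i] (ex_intro _ n Bi)).
pose w : unit_cube I k := cut (\bigcup_n B n) (fun i => y (p i) i).
pose g := BoundedDual (bounded_dual_comp f (gather_linear p w)).
apply: (@nat_coefs_not_away_from_0 g e e0) => n /=.
rewrite (_ : gather _ _ _ = cut (B n) (y n))//.
apply/funext => i; rewrite /gather /cube_unit /w /cut.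
have [Bi|Bi] := asboolP (B n i).
  rewrite (pB n i Bi) eqxx mul1r; case: asboolP => // -[]; by exists n.
case: asboolP => [[n' _ Bi']|_]; last by rewrite mulr0.
rewrite (pB n' i Bi'); case: eqP => [E|_]; last by rewrite mul0r.
by rewrite E in Bi'.
Qed.

Lemma cut_set1 i z : cut [set i] z = z i *: cube_unit i.
Proof.
apply/funext => j; rewrite /cut [RHS](_ : _ = z i * (j == i)%:R)//.
by case: asboolP => [->|/eqP/negPf ->]; rewrite ?eqxx ?mulr1 ?mulr0.
Qed.

Lemma coefs_C0 f : C0_pred (fun i => f (cube_unit i)).
Proof.
apply/asboolP => e e0; apply: contrapT => /infiniteP/card_leP[h].
pose p (n : nat) : I := val (h (to_setT n)).
have p_inj : injective p.
  by move=> n n' /val_inj/inj H; have [] := H (in_setT _) (in_setT _).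
have p_big n : e <= vabs (f (cube_unit (p n)) : k) by exact: set_valP (h _).
apply: (@cut_disjoint_not_away_from_0 f e (fun n => [set p n])
  (fun n => cube_unit (p n)) e0) => [|n].
  by move=> n n' _ _ [i [/= -> /p_inj]].
by rewrite cut_set1 {1}/cube_unit eqxx scale1r; exact: p_big.
Qed.

Definition coefs f : C0 I k := MkC0 (coefs_C0 f).

Lemma coefs_cube_unit f i : pairing (coefs f) (cube_unit i) = f (cube_unit i).
Proof. exact: pairing_cube_unit. Qed.

End AnyIndex.

(** On nat, f is the pairing with its coefficients, by [bounded_dual_nat_eq0];
    thus f inherits the bounds on its coefficients without any loss. *)
Lemma bounded_dual_nat_le (f : bounded_dual (unit_cube nat k)) (C : R) :
  0 <= C -> (forall n, vabs (f (cube_unit n)) <= C) -> forall z, vabs (f z) <= C.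
Proof.
move=> C0 fC z; suff -> : f z = pairing (coefs f) z by exact: pairing_le.
apply/eqP; rewrite -subr_eq0; apply/eqP.
apply: (@bounded_dual_nat_eq0 _ _ (f - pairing_functional (coefs f)) nsc) => n.
by rewrite [LHS](_ : _ = f (cube_unit n) - pairing (coefs f) (cube_unit n))//
  coefs_cube_unit subrr.
Qed.

Section Negligible.
Context {I : choiceType} (f : bounded_dual (unit_cube I k)) (e : R).
Implicit Types (z : unit_cube I k) (A B : set I).

Definition negligible A := forall z, vabs (f (cut A z)) <= e.

Lemma negligibleS A B : A `<=` B -> negligible B -> negligible A.
Proof.
move=> AB Bn z; rewrite (_ : cut A z = cut B (cut A z)); first exact: Bn.
apply/funext => i; rewrite /cut; case: (asboolP (A i)) => [Ai|_]; last by case: ifP.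
by case: asboolP => // Bi; case: Bi; apply: AB.
Qed.

(** Choosing for each point of the union one A_n containing it pulls f back to
    the cube over nat, with coefficients at most e. *)
Lemma negligible_bigcup (A : nat -> set I) : 0 <= e ->
  (forall n, negligible (A n)) -> negligible (\bigcup_n A n).
Proof.
move=> e0 An z; pose p i : nat := xget 0%N [set n | A n i].
have pA n i : A n i -> A (p i) i.
  by move=> Ai; apply: (@xgetPex _ 0%N [set n | A n i]); exists n.
pose w := cut (\bigcup_n A n) z.
pose g := BoundedDual (bounded_dual_comp f (gather_linear p w)).
suff : vabs (g (fun=> 1)) <= e.
  rewrite /= (_ : gather _ _ _ = w)//.
  by apply/funext => i; rewrite /gather mul1r.
apply: bounded_dual_nat_le => // n /=.
rewrite (_ : gather _ _ _ = cut (A n) (gather p w (cube_unit n))); first exact: An.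
apply/funext => i; rewrite [RHS]/cut; case: asboolP => // nAi.
rewrite /gather /cube_unit; case: eqP => [pn|_]; last by rewrite mul0r.
rewrite /w /cut; case: asboolP => [[n' _ /pA]|]; last by rewrite mulr0.
by rewrite pn.
Qed.

End Negligible.
End Coefficients.

(** * Sigma-ideals on a non-measurable set *)

Section SigmaIdeal.
Variables (I : Type) (N : set (set I)).
Hypothesis NS : forall A B, A `<=` B -> N B -> N A.
Hypothesis N_bigcup : forall A : nat -> set I, (forall n, N (A n)) -> N (\bigcup_n A n).
Hypothesis N1 : forall i, N [set i].
Hypothesis N_disjoint : forall B : nat -> set I, trivIset setT B -> exists n, N (B n).

Lemma sigma_ideal0 : N set0.
Proof. by have [] := N_disjoint (@trivIset_set0 nat I setT). Qed.

Lemma sigma_idealU A B : N A -> N B -> N (A `|` B).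
Proof.
move=> NA NB; rewrite -bigcup2E; apply: N_bigcup => -[|[|n]] //=.
exact: sigma_ideal0.
Qed.

Lemma sigma_ideal_countable : countable [set: I] -> N setT.
Proof.
move=> /countable_injP[c c_inj].
apply: (@NS _ (\bigcup_n (c @^-1` [set n]))) => [i _|]; first by exists (c i).
apply: N_bigcup => n; have [[i ci]|nci] := pselect (exists i, c i = n).
  apply: NS (N1 i) => j /= cj; apply: c_inj; rewrite ?in_setT//.
  by rewrite cj.
by apply: NS sigma_ideal0 => i /= ci; apply: nci; exists i.
Qed.

(** Otherwise, splitting the remaining part again and again produces infinitely
    many disjoint sets outside the ideal. *)
Lemma sigma_ideal_atom : ~ N setT ->
  exists2 A, ~ N A & forall B, N (A `&` B) \/ N (A `\` B).
Proof.
move=> NT; apply: contrapT => noatom.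
have /choice[s sP] A : exists B, ~ N A -> ~ N (A `&` B) /\ ~ N (A `\` B).
  have [NA|NA] := pselect (N A); first by exists set0.
  apply: contrapT => As; apply: noatom; exists A => // B.
  have [NAB|NAB] := pselect (N (A `&` B)); first by left.
  by right; apply: contrapT => NADB; apply: As; exists B.
pose A n := iter n (fun A => A `\` s A) setT.
have An n : ~ N (A n) by elim: n => // n /sP[].
have A_decr n m : (n <= m)%N -> A m `<=` A n.
  move=> /subnK <-; elim: (m - n)%N => // d IHd; rewrite addSn.
  by apply: subset_trans IHd; exact: subDsetl.
have [n] : exists n, N (A n `&` s (A n)).
  apply: N_disjoint; apply: ltn_trivIset => m n mn.
  apply/seteqP; split=> // i [[Am sm] [An' _]].
  by have [_] := A_decr _ _ mn i An'; apply.
by have [] := sP _ (An n).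
Qed.

(** If N is proper, the sets containing an atom A up to N form an ultrafilter
    because A is an atom, countably complete because N is a sigma-ideal, and
    non-principal because N contains the singletons. *)
Lemma sigma_ideal_full : non_measurable I -> N setT.
Proof.
move=> nm; apply: contrapT => NT; apply: nm; split.
  by move=> /sigma_ideal_countable.
have [A NA A_atom] := sigma_ideal_atom NT.
pose U : set_system I := [set B | N (A `\` B)].
have UI B C : U B -> U C -> U (B `&` C).
  by move=> UB UC; rewrite /U /= setDIr; exact: sigma_idealU.
have U0 : ~ U set0 by rewrite /U /= setD0.
have UC B : U B \/ U (~` B).
  by rewrite /U /= [A `\` ~` B]setDE setCK; have [] := A_atom B; [right|left].
exists U; split.
- split.
    split; first exact: U0.
    split => //; first by rewrite /U /= setDT; exact: sigma_ideal0.
    by move=> B C BC; apply: NS; exact: setDS.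
  move=> G [G0 GF] UG; apply/seteqP; split=> // B GB.
  have [//|/UG GCB] := UC B.
  by case: G0; rewrite -(setICr B); exact: filterI.
- move=> i Ui; apply: NA; apply: (@NS _ (A `\` [set i] `|` [set i])).
    by move=> j Aj; have [->|ji] := pselect (j = i); [right|left].
  apply: sigma_idealU (N1 i); suff : U [set i] by [].
  by rewrite Ui; exact/principal_filterP.
- move=> B UB; rewrite /U /= setDE setC_bigcap setI_bigcupr.
  by apply: N_bigcup => n; rewrite -setDE; exact: UB.
Qed.

End SigmaIdeal.

(** * Representation of bounded functionals on the cube *)

Section CubeDual.
Context {R : realType} {k : completeValuationFieldType R} {I : choiceType}.
Hypothesis (hk : nontrivially_valued k) (nsc : non_spherically_complete k).
Hypothesis (nmI : non_measurable I).

Lemma bounded_dual_eq0 (f : bounded_dual (unit_cube I k)) :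
  (forall i, f (cube_unit i) = 0) -> forall z, f z = 0.
Proof.
move=> f0 z; apply/vabs_eq0/eqP; rewrite eq_le vabs_ge0 andbT.
apply/ler_addgt0Pr => e e0; rewrite add0r.
suff : negligible f e setT.
  move=> /(_ z); congr (vabs (f _) <= e).
  by apply/funext => i; rewrite /cut asboolT.
apply: sigma_ideal_full nmI => [A B|A||B tB].
- exact: negligibleS.
- by apply: negligible_bigcup => //; exact: ltW.
- by move=> i w; rewrite cut_set1 linearZ /= f0 mulr0 vabs0 ltW.
- apply: contrapT => nB.
  have /choice[y yP] n : exists w, e <= vabs (f (cut (B n) w)).
    apply: contrapT => nw; apply: nB; exists n => w; rewrite leNgt.
    by apply/negP => /ltW ew; apply: nw; exists w.
  exact: (@cut_disjoint_not_away_from_0 _ _ hk nsc _ f e B y e0 tB).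
Qed.

Lemma bounded_dual_cubeE (f : bounded_dual (unit_cube I k)) :
  exists a : C0 I k, forall z, f z = pairing a z.
Proof.
pose a := coefs hk nsc f; exists a => z; apply/eqP; rewrite -subr_eq0; apply/eqP.
apply: (@bounded_dual_eq0 (f - pairing_functional a)) => i.
by rewrite [LHS](_ : _ = f (cube_unit i) - pairing a (cube_unit i))//
  coefs_cube_unit subrr.
Qed.

End CubeDual.

(** * Dual pairings and double duals *)

Section DualPairing.
Context {R : realType} {k : completeValuationFieldType R}.

Lemma inj_surj_bijective (T U : Type) (h : T -> U) :
  injective h -> (forall y, exists x, h x = y) -> bijective h.
Proof. by move=> h_inj /choice[g hg]; exists g => // x; apply: h_inj. Qed.

Lemma isometry_inj (V W : banachType k) (h : V -> W) : linear h ->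
  (forall v, bnorm (h v) = bnorm v) -> injective h.
Proof.
move=> hl h_norm u v huv; apply/eqP; rewrite -subr_eq0; apply/eqP.
apply/bnorm_eq0; rewrite -h_norm; apply/bnorm_eq0.
by rewrite -scaleN1r addrC hl huv scaleN1r addNr.
Qed.

(** B identifies M with the unit dual of V, and its left argument is isometric.
    Working with a bilinear function, instead of isomorphisms between the types
    of functionals, makes transport a mere precomposition. *)
Record dual_pairing (V : banachType k) (M : lmodType (valring k))
    (B : V -> M -> k) : Prop := DualPairing {
  dual_pairing_linearl : forall m, scalar (B^~ m);
  dual_pairing_linearr : forall v,
    GRing.linear_for (val \; *%R : valring k -> k -> k) (B v);
  dual_pairing_le : forall v m, vabs (B v m) <= bnorm v;
  dual_pairing_ge : forall v (C : R),
    0 <= C -> (forall m, vabs (B v m) <= C) -> bnorm v <= C;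
  dual_pairing_inj : forall m n, (forall v, B v m = B v n) -> m = n;
  dual_pairing_surj : forall f : unit_dual V, exists m, forall v, f v = B v m }.

(** Kept apart from [dual_pairing]: for the basic pairing this half depends on
    the failure of spherical completeness and on the index set. *)
Definition reflexive_pairing (V : banachType k) (M : lmodType (valring k))
    (B : V -> M -> k) : Prop :=
  forall f : bounded_dual M, exists v, forall m, f m = B v m.

Section Consequences.
Variables (V : banachType k) (M : lmodType (valring k)) (B : V -> M -> k).
Hypothesis BP : dual_pairing B.

Lemma eval_right_subproof m : unit_dual_pred (B^~ m).
Proof.
apply/asboolP; split; first exact: dual_pairing_linearl.
by move=> v; exact: dual_pairing_le.
Qed.

Definition eval_right m : unit_dual V := UnitDual (eval_right_subproof m).

Lemma eval_right_linear : linear eval_right.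
Proof.
by move=> c m n; apply/val_inj/funext => v; exact: (dual_pairing_linearr BP).
Qed.

Lemma eval_left_subproof v : bounded_dual_pred (B v).
Proof.
apply/asboolP; split; first exact: dual_pairing_linearr.
by exists (bnorm v) => m; exact: dual_pairing_le.
Qed.

Definition eval_left v : bounded_dual M := BoundedDual (eval_left_subproof v).

Lemma eval_left_linear : linear eval_left.
Proof.
by move=> c u v; apply/val_inj/funext => m; exact: (dual_pairing_linearl BP).
Qed.

Lemma eval_left_norm v : bnorm (eval_left v) = bnorm v.
Proof.
apply/eqP; rewrite eq_le; apply/andP; split.
  by apply: supnorm_le => [|m]; [exact: bnorm_ge0|exact: (dual_pairing_le BP)].
apply: (dual_pairing_ge BP) => [|m]; first exact: bnorm_ge0.
exact: (supnorm_ub m (bounded_dual_bounded (eval_left v))).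
Qed.

Lemma unit_dual_iso : exists h : {linear unit_dual V -> M}, lmod_iso h.
Proof.
have [h hP] := choice (dual_pairing_surj BP).
have hl : linear h.
  move=> c f g; apply: (dual_pairing_inj BP) => v.
  by rewrite (dual_pairing_linearr BP) /= -!hP.
pose H : {linear unit_dual V -> M} :=
  HB.pack h (GRing.isLinear.Build _ _ _ _ h hl).
exists H; apply: inj_surj_bijective => [f g fg|m].
  by apply/val_inj/funext => v /=; rewrite !hP [h f]fg.
by exists (eval_right m); apply: (dual_pairing_inj BP) => v; rewrite -hP.
Qed.

Hypothesis B_refl : reflexive_pairing B.

(** After identifying unit_dual V with M, the canonical map becomes
    [eval_left]. *)
Lemma banach_bidual_iso : isometric_iso (@banach_bidual R k V).
Proof.
have norm_eq (v : V) : bnorm (banach_bidual v) = bnorm v.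
  apply/eqP; rewrite eq_le; apply/andP; split.
    by apply: supnorm_le => [|f]; [exact: bnorm_ge0|exact: unit_dual_le].
  apply: (dual_pairing_ge BP) => [|m]; first exact: bnorm_ge0.
  exact: (supnorm_ub (eval_right m) (bounded_dual_bounded (banach_bidual v))).
split=> //; apply: inj_surj_bijective.
  by apply: isometry_inj norm_eq; exact: banach_bidual_linear.
move=> F; have [v vP] := B_refl (BoundedDual (bounded_dual_comp F eval_right_linear)).
exists v; apply/val_inj/funext => f /=; have [m fm] := dual_pairing_surj BP f.
by rewrite fm -vP /=; congr (F _); apply/val_inj/funext => u /=.
Qed.

Lemma bounded_dual_iso : exists h : {linear V -> bounded_dual M}, isometric_iso h.
Proof.
pose H : {linear V -> bounded_dual M} :=
  HB.pack eval_left (GRing.isLinear.Build _ _ _ _ _ eval_left_linear).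
exists H; split; last exact: eval_left_norm.
apply: inj_surj_bijective => [|f].
  by apply: isometry_inj eval_left_norm; exact: eval_left_linear.
by have [v fv] := B_refl f; exists v; apply/val_inj/funext => m /=; rewrite fv.
Qed.

(** After identifying bounded_dual M with V, the canonical map becomes
    [eval_right]. *)
Lemma module_bidual_iso : lmod_iso (@module_bidual R k M).
Proof.
apply: inj_surj_bijective => [m n mn|F].
  apply: (dual_pairing_inj BP) => v.
  exact: (congr1 (fun G : unit_dual (bounded_dual M) => G (eval_left v)) mn).
have FP : unit_dual_pred (F \o eval_left).
  apply/asboolP; split=> [c u v|v] /=.
    by rewrite eval_left_linear linearP.
  by rewrite (le_trans (unit_dual_le _ _))// eval_left_norm.
have [m mP] := dual_pairing_surj BP (UnitDual FP).
exists m; apply/val_inj/funext => f /=; have [v fv] := B_refl f.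
by rewrite fv -mP /=; congr (F _); apply/val_inj/funext => n /=; rewrite fv.
Qed.

End Consequences.

Section Transport.
Variables (V V' : banachType k) (M M' : lmodType (valring k)).
Variables (B : V' -> M' -> k) (p : {linear V -> V'}) (q : {linear M -> M'}).
Variables (p' : V' -> V) (q' : M' -> M).
Hypothesis (pK : cancel p p') (p'K : cancel p' p).
Hypothesis (p_norm : forall v, bnorm (p v) = bnorm v).
Hypothesis (qK : cancel q q') (q'K : cancel q' q).

Lemma dual_pairing_transport : dual_pairing B ->
  dual_pairing (fun v m => B (p v) (q m)).
Proof.
have p'_lin : linear p' := can2_linear pK p'K.
move=> BP; split=> [m c u v|v c m n|v m|v C C0 vC|m n mn|f].
- by rewrite linearP (dual_pairing_linearl BP).
- by rewrite linearP (dual_pairing_linearr BP).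
- by rewrite -p_norm (dual_pairing_le BP).
- rewrite -p_norm; apply: (dual_pairing_ge BP) => // m.
  by rewrite -[m]q'K; exact: vC.
- rewrite -[m]qK -[n]qK; congr q'; apply: (dual_pairing_inj BP) => v.
  by rewrite -[v]p'K; exact: mn.
have fP : unit_dual_pred (f \o p').
  apply/asboolP; split=> [c u v|v] /=; first by rewrite p'_lin linearP.
  by rewrite -[v in leRHS]p'K p_norm unit_dual_le.
have [m mP] := dual_pairing_surj BP (UnitDual fP).
by exists (q' m) => v; rewrite q'K -mP /= pK.
Qed.

Lemma reflexive_pairing_transport : reflexive_pairing B ->
  reflexive_pairing (fun v m => B (p v) (q m)).
Proof.
have q'_lin : linear q' := can2_linear qK q'K.
move=> B_refl f; have [v vP] := B_refl (BoundedDual (bounded_dual_comp f q'_lin)).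
by exists (p' v) => m; rewrite p'K -vP /= qK.
Qed.

End Transport.

Lemma pairing_dual (I : choiceType) :
  dual_pairing (pairing : C0 I k -> unit_cube I k -> k).
Proof.
split=> [m||||m n mn|f].
- exact: pairing_linearl.
- exact: pairing_linearr.
- exact: pairing_norm.
- move=> a C C0 aC; apply: supnorm_le => // i.
  by rewrite -pairing_cube_unit.
- by apply/funext => i; apply/val_inj; rewrite -!pairing_C0_unit.
by exists (cube_of f) => a; rewrite pairing_cube_of.
Qed.

End DualPairing.

Theorem theorem4p2 (R : realType) (k : completeValuationFieldType R)
    (hk : nontrivially_valued k) :
  (forall V : banachType k, free_banach V ->
     cofree_module (unit_dual V) /\
     (non_spherically_complete k -> isometric_iso (@banach_bidual R k V))) /\
  (non_spherically_complete k ->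
     forall M : lmodType (valring k), cofree_module M ->
       free_banach (bounded_dual M) /\ lmod_iso (@module_bidual R k M)).
Proof.
(* The classical structure on I gives the decidable equality that unit vectors
   require. *)
have refl (I : Type) : non_measurable I -> non_spherically_complete k ->
    reflexive_pairing (pairing : C0 {classic I} k -> unit_cube {classic I} k -> k).
  by move=> nmI nsc f; exact: (bounded_dual_cubeE hk nsc).
split=> [V [I nmI [f [[g fK gK] f_norm]]]|nsc M [I nmI [f [g fK gK]]]].
  pose G : {linear V -> C0 {classic I} k} :=
    HB.pack g (GRing.isLinear.Build _ _ _ _ g (can2_linear fK gK)).
  have g_norm v : bnorm (G v) = bnorm v by rewrite -f_norm gK.
  pose q : {linear unit_cube {classic I} k -> unit_cube {classic I} k} := idfun.
  have qK : cancel q id by [].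
  have BP := dual_pairing_transport (p := G) (q := q) gK fK g_norm qK qK
    (pairing_dual _).
  split; first by exists {classic I} => //; exact: unit_dual_iso BP.
  move=> nsc; apply: (banach_bidual_iso BP).
  exact: (reflexive_pairing_transport (p := G) (q := q) fK qK qK (refl I nmI nsc)).
pose p : {linear C0 {classic I} k -> C0 {classic I} k} := idfun.
have pK : cancel p id by [].
pose F : {linear M -> unit_cube {classic I} k} := f.
have BP := dual_pairing_transport (p := p) (q := F) pK pK (fun=> erefl) fK gK
  (pairing_dual _).
have B_refl := reflexive_pairing_transport (p := p) (q := F) pK fK gK (refl I nmI nsc).
split; last exact: module_bidual_iso BP B_refl.
by exists {classic I} => //; exact: bounded_dual_iso BP B_refl.
Qed.
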